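(* Let $|\varphi\rangle$ and $|\chi\rangle$ be two partially entangled states. If $|\chi\rangle$ has at least two distinct nonzero Schmidt coefficients, then there exists a positive integer $k_0$ such that for any $k\geq k_0$ and any $|\psi\rangle\in S^o(|\varphi\rangle)$, entanglement lost in the transformation of $|\psi\rangle^{\otimes k}$ to $|\varphi\rangle^{\otimes k}$ can be partially recovered by $|\chi\rangle$, i.e., $|\chi\rangle$ can do partial entanglement recovery for the transformation of $|\psi\rangle^{\otimes k}$ to $|\varphi\rangle^{\otimes k}$.
   Context: An $n\times n$ state $|\psi\rangle$ is a bipartite pure state in $\mathbb{C}^n\otimes\mathbb{C}^n$ with Schmidt decomposition $\sum_i\sqrt{\alpha_i}|i_A\rangle|i_B\rangle$; $\psi=(\alpha_1,\dots,\alpha_n)$ is its Schmidt coefficient (probability) vector, $\alpha_1\ge\dots\ge\alpha_n\ge0$. It is maximally entangled if all $\alpha_i=1/n$, and partially entangled otherwise. Tensor products of states correspond to Kronecker products of vectors (up to order). With $e_l(x)$ the sum of the $l$ largest components of $x$ and $x,y$ of dimension $N$: $x\prec y$ means $e_l(x)\le e_l(y)$ for $1\le l<N$ and $e_N(x)=e_N(y)$; $x\lhd y$ means $e_l(x)<e_l(y)$ for $1\le l<N$ and $e_N(x)=e_N(y)$. $S^{o}(|\varphi\rangle)$ is the set of states $|\psi\rangle$ of the same dimension as $|\varphi\rangle$ with $\psi\lhd\varphi$. Partial entanglement recovery: an $r\times r$ state $|\chi\rangle$ can do partial entanglement recovery for the transformation of $|\psi\rangle$ to $|\varphi\rangle$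 if there is an $r\times r$ state $|\omega\rangle$ with $\psi\otimes\chi\prec\varphi\otimes\omega$, $\omega\prec\chi$ and $\omega^{\downarrow}\ne\chi^{\downarrow}$ ($x^{\downarrow}$ is the non-increasing rearrangement); by Nielsen's theorem this expresses deterministic LOCC transformability $|\psi\rangle\otimes|\chi\rangle\to|\varphi\rangle\otimes|\omega\rangle$ with $|\omega\rangle$ strictly more entangled than $|\chi\rangle$. *)

(* Defs.v *)
From HB Require Import structures.
From mathcomp Require Import all_boot all_order all_fingroup all_algebra.
From mathcomp Require Import boolp reals.
From mathcomp Require Import complex mxtens.

Set Implicit Arguments.
Unset Strict Implicit.
Unset Printing Implicit Defensive.

Import Order.TTheory GRing.Theory Num.Theory.
Local Open Scope ring_scope.
Local Open Scope sesquilinear_scope.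

Section OrthonormalComplete.
Variable C : numClosedFieldType.

Lemma orthonormal_complete n (S : {set 'I_n}) (U : 'M[C]_n) :
    U *m U ^t* = diag_mx (\row_i (i \in S)%:R) ->
  exists2 V : 'M[C]_n, V \is unitarymx & forall i, i \in S -> row i V = row i U.
Proof.
move: {2}#|~: S| (erefl #|~: S|) => k; elim: k S U => [|k IH] S U cS hU.
  have ST : S = [set: 'I_n] by apply: setC_inj; rewrite setCT; apply: cards0_eq.
  exists U => //; apply/unitarymxP; rewrite hU ST.
  rewrite -diag_const_mx; congr diag_mx.
  by apply/rowP => i; rewrite !mxE inE.
have /card_gt0P[i0] : (0 < #|~: S|)%N by rewrite cS.
rewrite inE => i0S.
have hUE i j : \sum_l U i l * (U j l)^* = ((i \in S) && (i == j))%:R.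
  move/matrixP/(_ i j): hU; rewrite !mxE.
  under eq_bigr do rewrite !mxE.
  by move=> ->; case: (i \in S); case: (i == j).
have U0 l : U i0 l = 0.
  have := hUE i0 i0; rewrite (negbTE i0S) /= => /eqP.
  rewrite psumr_eq0 => [|m _]; last by rewrite -normCK exprn_ge0.
  move/allP/(_ l (mem_index_enum _)) => /=.
  by rewrite -normCK sqrf_eq0 normr_eq0 => /eqP.
have kU : kermx (U ^t*) != 0.
  rewrite kermx_eq0 row_free_unit; apply/negP => uU.
  move: uU; rewrite map_unitmx unitmx_tr => uU.
  have : delta_mx 0 i0 *m U = 0 :> 'rV[C]_n.
    by apply/rowP => l; rewrite -rowE !mxE U0.
  move/(congr1 (mulmx^~ (invmx U))); rewrite mulmxK // mul0mx.
  by move=> /rowP/(_ i0); rewrite !mxE !eqxx /= => /eqP; rewrite oner_eq0.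
have [j kj] : exists j, row j (kermx (U ^t*)) != 0.
  by apply/existsP; apply: contraNT kU; rewrite negb_exists => /forallP h;
     apply/eqP/row_matrixP => j; rewrite row0; move: (h j); rewrite negbK => /eqP.
set w := row j _ in kj.
have wU : w *m U ^t* = 0 by rewrite /w -row_mul mulmx_ker row0.
move: w kj wU => {j} w w0 wU.
pose c : C := \sum_l `|w 0 l| ^+ 2.
have c0 : 0 < c.
  rewrite lt_neqAle sumr_ge0 ?andbT => [|l _]; last by rewrite exprn_ge0.
  apply: contraNN w0; rewrite eq_sym psumr_eq0 => [/allP h|l _]; last by rewrite exprn_ge0.
  apply/eqP/rowP => l; rewrite [RHS]mxE; apply/eqP.
  by have := h l (mem_index_enum _); rewrite /= sqrf_eq0 normr_eq0.
pose v := (sqrtC c)^-1 *: w.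
have vU i : \sum_l v 0 l * (U i l)^* = 0.
  transitivity ((v *m U ^t*) 0 i).
    by rewrite [RHS]mxE; apply: eq_bigr => l _; rewrite !mxE.
  by rewrite -scalemxAl wU scaler0 mxE.
have Uv i : \sum_l U i l * (v 0 l)^* = 0.
  have := congr1 (fun z : C => z^*) (vU i); rewrite rmorph0 rmorph_sum /= => h.
  by rewrite -[RHS]h; apply: eq_bigr => l _; rewrite rmorphM /= conjCK mulrC.
have vv : \sum_l v 0 l * (v 0 l)^* = 1.
  under eq_bigr do rewrite -normCK !mxE normrM exprMn.
  rewrite -mulr_sumr -/c -normrX exprVn sqrtCK ger0_norm ?invr_ge0 ?ltW //.
   by rewrite mulVf // gt_eqF.
clearbody v.
pose U' : 'M[C]_n := \matrix_(i, l) if i == i0 then v 0 l else U i l.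
have [||V uV hV] := IH (i0 |: S) U'.
- apply/eqP; rewrite -eqSS -cS; apply/eqP.
  by rewrite setCU setIC -setDE [RHS](cardsD1 i0) inE i0S.
- apply/matrixP => i l; rewrite !mxE; under eq_bigr do rewrite !mxE.
  rewrite !inE.
  case: (eqVneq i i0) => [ei|ni]; case: (eqVneq l i0) => [el|nl] /=.
  + by rewrite vv ei el eqxx.
  + by rewrite vU ei [i0 == l]eq_sym (negbTE nl).
  + by rewrite Uv el (negbTE ni).
  + by rewrite hUE; case: (i \in S); case: (i == l).
exists V => // i iS; rewrite hV ?inE ?iS ?orbT //.
apply/rowP => l; rewrite !mxE; case: eqP => // ii0.
by move: i0S; rewrite -ii0 iS.
Qed.

End OrthonormalComplete.

Local Open Scope complex_scope.

Definition norm2 (R : realType) m n (A : 'M[R[i]]_(m, n)) : R[i] :=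
  \sum_i \sum_j `|A i j| ^+ 2.

(* An n x n bipartite pure state, given by its amplitudes in the product of
   the computational bases: |psi> = \sum_(j, k) (amp psi) j k |j>|k>. *)
Record state (R : realType) (n : nat) := State {
  amp :> 'M[R[i]]_n;
  state_norm : norm2 amp = 1
}.

(* A = \sum_i sqrt (a_i) |u_i>|v_i>, with (u_i) and (v_i) the rows of two
   unitary matrices, i.e. two orthonormal bases of C^n. *)
Definition schmidt_decomposition (R : realType) n (A : 'M[R[i]]_n)
    (a : 'rV[R]_n) : Prop :=
  [/\ forall i, 0 <= a 0 i,
      forall i j : 'I_n, (i <= j)%N -> a 0 j <= a 0 i
    & exists U V : 'M[R[i]]_n, [/\ U \is unitarymx, V \is unitarymx
      & A = \sum_i (Num.sqrt (a 0 i))%:C *: ((row i U)^T *m row i V)]].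


Lemma schmidt_decomposition_exists (R : realType) n (A : 'M[R[i]]_n) :
  exists a, schmidt_decomposition A a.
Proof.
pose H := A *m A ^t*.
have HN : H \is normalmx.
  by apply/normalmxP; rewrite /H trmx_mul map_mxM trmxCK.
have /orthomx_spectralP := HN.
set P := spectralmx H; set d := spectral_diag H => HE.
have PU : P \is unitarymx by apply: spectral_unitarymx.
have Pu := unitarymx_unit PU.
pose W := P *m A.
have WE i j : \sum_l W i l * (W j l)^*%R = d 0 j *+ (i == j).
  have /matrixP/(_ i j) : W *m W ^t* = diag_mx d.
    rewrite /W trmx_mul map_mxM mulmxA -[P *m A *m _]mulmxA -/H HE.
    by rewrite -(invmx_unitary PU) !mulmxA mulmxV // mul1mx mulmxK.
  rewrite [LHS]mxE [RHS]mxE => h.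
  transitivity (d 0 i *+ (i == j)); last by case: eqP => [->|].
  by rewrite -h; apply: eq_bigr => l _; rewrite !mxE.
have AE : A = P ^t* *m W by rewrite /W mulmxA -invmx_unitary // mulVmx // mul1mx.
clearbody W.
have d0 i : 0 <= d 0 i.
  move: (WE i i); rewrite eqxx mulr1n => <-.
  by apply: sumr_ge0 => l _; rewrite -normCK exprn_ge0.
pose b i := complex.Re (d 0 i).
have bE i : (b i)%:C = d 0 i by apply/eqP; rewrite RRe_real // ger0_real.
have b0 i : 0 <= b i by rewrite -ler0c bE.
pose t := [tuple b i | i < n].
have [p pE] : exists p : 'S_n,
    sort >=%R t = [tuple tnth t (p i) | i < n] :> seq R.
  by apply/tuple_permP; rewrite perm_sort.
pose a : 'rV[R]_n := \row_i b (p i).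
have aB i : a 0 i = b (p i) by rewrite mxE.
clearbody a.
have aE (i : 'I_n) : nth 0 (sort >=%R t) i = a 0 i.
  by rewrite pE -tnth_nth !tnth_mktuple aB.
have aC i : (Num.sqrt (a 0 i))%:C ^+ 2 = d 0 (p i).
  by rewrite -rmorphXn /= sqr_sqrtr aB // bE.
pose S := [set i | a 0 i != 0].
pose U0 : 'M[R[i]]_n :=
  \matrix_(i, l) if a 0 i == 0 then 0 else (Num.sqrt (a 0 i))%:C^-1 * W (p i) l.
have sC i : ((Num.sqrt (a 0 i))%:C)^*%R = (Num.sqrt (a 0 i))%:C :> R[i].
  by apply: conj_Creal; rewrite complex_real.
have s0 i : a 0 i != 0 -> (Num.sqrt (a 0 i))%:C != 0 :> R[i].
  move=> ai; rewrite fmorph_eq0 sqrtr_eq0 -ltNge lt_neqAle eq_sym ai.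
  by rewrite aB b0.
have [V VU VE] : exists2 V : 'M[R[i]]_n, V \is unitarymx
    & forall i, i \in S -> row i V = row i U0.
  apply: orthonormal_complete; apply/matrixP => i j; rewrite !mxE.
  under eq_bigr do rewrite !mxE.
  rewrite inE; have [ai|ai] := eqVneq (a 0 i) 0.
    by rewrite big1 ?mul0rn // => l _; rewrite mul0r.
  have [aj|aj] := eqVneq (a 0 j) 0.
    rewrite big1 => [|l _]; last by rewrite rmorph0 mulr0.
    by case: (i =P j) ai => [->|//]; rewrite aj eqxx.
  under eq_bigr do rewrite rmorphM mulrACA.
  rewrite -mulr_sumr WE (inj_eq perm_inj).
  have [<-|_] := eqVneq i j; last by rewrite mulr0.
  by rewrite fmorphV /= sC -invfM -expr2 aC mulVf // -aC expf_neq0 ?s0.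
have VW i l : (Num.sqrt (a 0 i))%:C * V i l = W (p i) l.
  have [ai|ai] := eqVneq (a 0 i) 0.
    rewrite ai sqrtr0 mul0r; have := WE (p i) (p i).
    rewrite eqxx -aC ai sqrtr0 expr0n mulr1n => /eqP.
    rewrite psumr_eq0 => [|m _]; last by rewrite -normCK exprn_ge0.
    move/allP/(_ l (mem_index_enum _)) => /=.
    by rewrite -normCK sqrf_eq0 normr_eq0 => /eqP.
  have /rowP/(_ l) : row i V = row i U0 by apply: VE; rewrite inE.
  by rewrite !mxE (negbTE ai) => ->; rewrite mulVKf ?s0.
exists a; split=> [i|i j ij|]; first by rewrite aB.
  have ts : sorted >=%R (sort >=%R t) by apply: sort_sorted; apply: ge_total.
  have := sorted_leq_nth ge_trans (fun x => lexx x) 0 ts.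
  move=> /(_ i j); rewrite !inE size_sort size_tuple !ltn_ord => /(_ isT isT ij).
  by rewrite !aE.
exists (row_perm p (map_mx Num.conj P)), V; split=> //.
  have /unitarymxP/matrixP QU : map_mx Num.conj P \is unitarymx.
    by rewrite conjC_unitary.
  apply/unitarymxP/matrixP => i j; move: (QU (p i) (p j)).
  rewrite !mxE (inj_eq perm_inj) => <-.
  by apply: eq_bigr => l _; rewrite !mxE.
apply/matrixP => k l; rewrite AE summxE mxE (reindex_inj (@perm_inj _ p)).
apply: eq_bigr => i _; rewrite !mxE big_ord1 !mxE -VW.
by rewrite mulrCA.
Qed.

(* The Schmidt coefficients of psi, in non-increasing order. They are
   determined by psi: they are the eigenvalues of amp psi *m (amp psi) ^t*. *)
Definition schmidt_vector (R : realType) n (psi : state R n) : 'rV[R]_n :=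
  projT1 (cid (schmidt_decomposition_exists psi)).

Lemma norm2_tens (R : realType) m n p q (A : 'M[R[i]]_(m, n))
  (B : 'M[R[i]]_(p, q)) : norm2 (A *t B) = norm2 A * norm2 B.
Proof.
rewrite /norm2 mulr_sum; apply: eq_bigr => i _.
rewrite mulr_sum; apply: eq_bigr => j _.
by rewrite mxE normrM exprMn.
Qed.

Lemma norm2_ntens (R : realType) n (A : 'M[R[i]]_n) k :
  norm2 A = 1 -> norm2 (ntensmx A k) = 1.
Proof.
move=> A1; case: k => [|k].
  by rewrite ntensmx0 /norm2 !big_ord1 mxE normr1 expr1n.
elim: k => [|k IH]; first by rewrite ntensmx1.
by rewrite ntensmxSS norm2_tens A1 IH mulr1.
Qed.

(* Entry ((j1, ..., jk), (l1, ..., lk)) of the Kronecker power is the amplitude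
   of |j1 ... jk>|l1 ... lk>: the first parties of the k copies are grouped
   together, and so are the second ones. *)
Definition tensor_power (R : realType) n (psi : state R n) k : state R (n ^ k) :=
  State (norm2_ntens k (state_norm psi)).

Definition maximally_entangled (R : realType) n (psi : state R n) : Prop :=
  forall i, schmidt_vector psi 0 i = n%:R^-1.

Definition partially_entangled (R : realType) n (psi : state R n) : Prop :=
  ~ maximally_entangled psi.

Definition kron (R : realType) m n (x : 'rV[R]_m) (y : 'rV[R]_n) :
  'rV[R]_(m * n) := x *t y.

Definition decreasing (R : realType) n (x : 'rV[R]_n) : seq R :=
  sort >=%R [seq x 0 i | i <- enum 'I_n].

Definition largest_sum (R : realType) n (l : nat) (x : 'rV[R]_n) : R :=
  \sum_(a <- take l (decreasing x)) a.

Definition majorized (R : realType) n (x y : 'rV[R]_n) : Prop :=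
  (forall l, (1 <= l < n)%N -> largest_sum l x <= largest_sum l y) /\
  largest_sum n x = largest_sum n y.

Definition strictly_majorized (R : realType) n (x y : 'rV[R]_n) : Prop :=
  (forall l, (1 <= l < n)%N -> largest_sum l x < largest_sum l y) /\
  largest_sum n x = largest_sum n y.

Definition So (R : realType) n (phi : state R n) (psi : state R n) : Prop :=
  strictly_majorized (schmidt_vector psi) (schmidt_vector phi).

(* The Schmidt vector of |psi>|chi> is, up to order, the Kronecker product of
   those of |psi> and |chi>. By Nielsen's theorem the first condition means that
   |psi>|chi> can be transformed by LOCC into |phi>|omega>, and the other two
   that omega is strictly more entangled than chi. *)
Definition partial_recovery (R : realType) n r (psi phi : state R n)
    (chi : state R r) : Prop :=
  exists omega : state R r,
    [/\ majorized (kron (schmidt_vector psi) (schmidt_vector chi))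
                  (kron (schmidt_vector phi) (schmidt_vector omega)),
        majorized (schmidt_vector omega) (schmidt_vector chi)
      & decreasing (schmidt_vector omega) <> decreasing (schmidt_vector chi)].

(* Main.v *)
Require Import Defs.
From mathcomp Require Import all_boot all_order all_fingroup all_algebra reals.
From mathcomp Require Import boolp complex mxtens ring lra.

(* Let psi be strictly majorized by phi, and let x and y be the Schmidt vectors
   of the k-fold tensor powers of psi and phi; x is again strictly majorized by
   y. An l-set T of entries of x (x) chi splits into one set of entries of x per
   coefficient chi_j. Bounding each of them by the best set of y of the same size
   gives a strict gain unless every set with chi_j > 0 is full or empty. For such
   T a gain is still possible as soon as a positive coefficient is left out, by
   exchanging y_min chi_j for y_max chi_j', because y_max / y_min is
   (phi_max / phi_min) ^ k, which is large whatever psi is. So all the inequalities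
   expressing that x (x) chi is majorized by y (x) chi are strict, except those at
   levels where all the positive coefficients are used up. Hence chi may be
   replaced by chi + eps (delta_j0 - delta_i0), with chi_i0 > chi_j0 > 0 and eps
   small: the strict inequalities survive, and the others are unaffected since the
   support of chi does not change. *)

Set Implicit Arguments.
Unset Strict Implicit.
Unset Printing Implicit Defensive.

Import Order.TTheory GRing.Theory Num.Theory.
Local Open Scope ring_scope.

(** * Majorization through sums over sets of indices, and tensor products *)

Section SetMajorization.
Variable F : realFieldType.
Implicit Types I J : finType.

(* The sum of the [l] largest entries is the maximum of the sums over the sets of
   size [l]: this is strict majorization without the equality of the totals. *)
Definition smaj I J (f : I -> F) (g : J -> F) :=
  forall S : {set I}, (0 < #|S| < #|I|)%N ->
  exists2 S' : {set J}, #|S'| = #|S| & \sum_(i in S) f i < \sum_(j in S') g j.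

Definition fiber I J (T : {set I * J}) (j : J) := [set i | (i, j) \in T].
Definition tens I J (f : I -> F) (g : J -> F) (p : I * J) := f p.1 * g p.2.

Lemma card_fibers I J (T : {set I * J}) : #|T| = (\sum_j #|fiber T j|)%N.
Proof.
rewrite -sum1_card (eq_bigr (fun j => (\sum_(i in fiber T j) 1)%N)); last first.
  by move=> j _; rewrite sum1_card.
rewrite (exchange_big_dep predT) //= pair_big_dep /=.
by apply: eq_bigl => -[i j]; rewrite inE.
Qed.

Lemma sum_fibers I J (T : {set I * J}) (f : I -> F) (g : J -> F) :
  \sum_(p in T) tens f g p = \sum_j g j * \sum_(i in fiber T j) f i.
Proof.
under [RHS]eq_bigr do rewrite mulr_sumr.
rewrite (exchange_big_dep predT) //= pair_big_dep /=.
by apply: eq_big => [[i j]|[i j] _]; rewrite ?inE // /tens mulrC.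
Qed.

Lemma sum_tens I J (f : I -> F) (g : J -> F) :
  \sum_p tens f g p = (\sum_i f i) * \sum_j g j.
Proof.
by rewrite mulr_suml; under [RHS]eq_bigr do rewrite mulr_sumr; rewrite pair_big.
Qed.

(** The sizes 0 and [#|I|], which [smaj] leaves out, give equal sums; they must be covered because
    the fibers of a set of pairs can have any size. *)
Lemma smaj_weak I (f g : I -> F) (S : {set I}) :
  smaj f g -> \sum_i f i = \sum_i g i ->
  exists S' : {set I}, [/\ #|S'| = #|S|, \sum_(i in S) f i <= \sum_(i in S') g i
    & (0 < #|S| < #|I|)%N -> \sum_(i in S) f i < \sum_(i in S') g i].
Proof.
move=> fg sfg; have [h|/negbTE h] := boolP (0 < #|S| < #|I|)%N.
  by have [S' cS lt] := fg S h; exists S'; split=> //; apply: ltW.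
exists S; split; rewrite ?h //.
move: h; case: (posnP #|S|) => [/cards0_eq->|_] /=; first by rewrite !big_set0.
move/negbT; rewrite -leqNgt -cardsT => cS.
have /eqP-> : S == setT by rewrite eqEcard subsetT.
have sT (h : I -> F) : \sum_(i in setT) h i = \sum_i h i.
  by apply: eq_bigl => i; rewrite inE.
by rewrite !sT sfg.
Qed.

(** Each fiber is replaced separately by a set of its own size. No fiber loses, so one strict gain
    at a positive weight is enough. *)
Lemma smaj_tensl I J (f g : I -> F) (z : J -> F) (T : {set I * J}) :
  smaj f g -> \sum_i f i = \sum_i g i -> (forall j, 0 <= z j) ->
  exists T' : {set I * J}, [/\ forall j, #|fiber T' j| = #|fiber T j|,
    \sum_(p in T) tens f z p <= \sum_(p in T') tens g z p
  & forall j, (0 < #|fiber T j| < #|I|)%N -> 0 < z j ->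
    \sum_(p in T) tens f z p < \sum_(p in T') tens g z p].
Proof.
move=> fg sfg z0.
have /fin_all_exists[S hS] := fun j => smaj_weak (fiber T j) fg sfg.
exists [set p | p.1 \in S p.2].
have cE j : fiber [set p | p.1 \in S p.2] j = S j.
  by apply/setP => i; rewrite !inE.
have le j : z j * (\sum_(i in fiber T j) f i) <= z j * (\sum_(i in S j) g i).
  by apply: ler_wpM2l => //; case: (hS j).
split=> [j||j hj zj]; rewrite ?cE; first by case: (hS j).
  by rewrite !sum_fibers; apply: ler_sum => j _; rewrite cE.
rewrite !sum_fibers (bigD1 j) //= [ltRHS](bigD1 j) //= cE; apply: ltr_leD.
  by rewrite ltr_pM2l //; case: (hS j) => _ _; apply.
by apply: ler_sum => j' _; rewrite cE.
Qed.

Definition swap I J (p : I * J) := (p.2, p.1).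
Lemma swapK I J : cancel (@swap I J) (@swap J I). Proof. by case. Qed.

Lemma sum_swap I J (f : I -> F) (g : J -> F) (T : {set I * J}) :
  \sum_(p in (@swap I J) @: T) tens g f p = \sum_(p in T) tens f g p.
Proof.
rewrite big_imset => [|p q _ _]; last exact: (can_inj (@swapK I J)).
by apply: eq_bigr => -[i j] _; rewrite /tens mulrC.
Qed.

Lemma card_swap I J (T : {set I * J}) : #|(@swap I J) @: T| = #|T|.
Proof. exact/card_imset/can_inj/swapK. Qed.

(** One factor is replaced at a time, [swap] exchanging their roles. If some fiber over [J] is
    neither empty nor full, replacing [f] first gives a strict gain; if some fiber over [I] is,
    replacing [f'] first does. *)
Lemma smaj_tens I J (f g : I -> F) (f' g' : J -> F) :
  smaj f g -> \sum_i f i = \sum_i g i ->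
  smaj f' g' -> \sum_j f' j = \sum_j g' j ->
  (forall i, 0 < f i) -> (forall j, 0 < f' j) ->
  (forall i, 0 <= g i) -> (forall j, 0 <= g' j) ->
  smaj (tens f f') (tens g g').
Proof.
move=> fg sfg fg' sfg' f0 f'0 g0 g'0 T /andP[T0 Tlt].
have [/existsP[j hj]|] := boolP [exists j, (0 < #|fiber T j| < #|I|)%N].
  have [|T1 [c1 _ lt]] := smaj_tensl T fg sfg (z := f'); first by move=> *; apply: ltW.
  have [T2 [c2 le _]] := smaj_tensl (swap (J:=J) @: T1) fg' sfg' g0.
  exists (swap (J:=I) @: T2).
    rewrite card_swap card_fibers; under eq_bigr do rewrite c2.
    by rewrite -card_fibers card_swap card_fibers; under eq_bigr do rewrite c1; rewrite -card_fibers.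
  by rewrite sum_swap; apply: lt_le_trans le; rewrite sum_swap; apply: lt hj _.
rewrite negb_exists => /forallP hc.
have [/existsP[i hi]|] := boolP [exists i, (0 < #|fiber (swap (J:=J) @: T) i| < #|J|)%N].
  have [|T1 [c1 _ lt]] := smaj_tensl (swap (J:=J) @: T) fg' sfg' (z := f).
    by move=> *; apply: ltW.
  have [T2 [c2 le _]] := smaj_tensl (swap (J:=I) @: T1) fg sfg g'0.
  exists T2.
    rewrite card_fibers; under eq_bigr do rewrite c2.
    rewrite -card_fibers card_swap card_fibers; under eq_bigr do rewrite c1.
    by rewrite -card_fibers card_swap.
  by apply: lt_le_trans le; rewrite sum_swap -(sum_swap f f'); apply: lt hi _.
(* All rows and columns of [T] are now empty or full, so a single pair in [T] forces every pair to
   be in it. *)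
rewrite negb_exists => /forallP hr; exfalso.
move: T0 => /card_gt0P[[i j] ijT].
move: Tlt; rewrite ltnNge => /negP; apply.
have cf j' i' : i' \in fiber T j' -> fiber T j' = setT.
  move=> hi'; apply/eqP; rewrite eqEcard subsetT cardsT leqNgt.
  move: (hc j'); rewrite negb_and => /orP[|//].
  by move/negP; case; apply/card_gt0P; exists i'.
have rf i' j' : j' \in fiber (swap (J:=J) @: T) i' -> fiber (swap (J:=J) @: T) i' = setT.
  move=> hi'; apply/eqP; rewrite eqEcard subsetT cardsT leqNgt.
  move: (hr i'); rewrite negb_and => /orP[|//].
  by move/negP; case; apply/card_gt0P; exists j'.
rewrite -cardsT; apply: subset_leq_card; apply/subsetP => -[i' j'] _.
have h1 : i' \in fiber T j by rewrite (@cf _ i) inE.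
have h2 : j \in fiber (swap (J:=J) @: T) i'.
  by rewrite inE in h1; rewrite inE; apply/imsetP; exists (i', j).
have : j' \in fiber (swap (J:=J) @: T) i' by rewrite (rf _ _ h2) inE.
by rewrite inE => /imsetP[[a b] hab [-> ->]].
Qed.

(** The sum of [f] away from [i] is strictly below a partial sum of [g], hence below the common
    total. *)
Lemma smaj_gt0 I (f g : I -> F) : (1 < #|I|)%N ->
  smaj f g -> \sum_i f i = \sum_i g i -> (forall i, 0 <= g i) ->
  forall i, 0 < f i.
Proof.
move=> I1 fg sfg g0 i.
have [|S' _ lt] := fg (~: [set i]).
  by rewrite cardsC1; case: #|I| I1 => [|[|k]] //= _; apply: leqnn.
have le : \sum_(j in S') g j <= \sum_j g j.
  rewrite [leRHS](bigID (mem S')) /= lerDl; exact: sumr_ge0.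
have : \sum_j f j = f i + \sum_(j in ~: [set i]) f j.
  by rewrite (bigD1 i) //=; congr (_ + _); apply: eq_bigl => j; rewrite !inE.
move=> h; have := lt_le_trans lt le; rewrite -sfg h; lra.
Qed.

Lemma pos_lower_bound I (f : I -> F) :
  exists2 c, 0 < c & forall i, 0 < f i -> c <= f i.
Proof.
(* Replacing the nonpositive values by 1 keeps the minimum over all of [I] positive. *)
pose g i := if 0 < f i then f i else 1.
have g0 i : 0 < g i by rewrite /g; case: ifP.
exists (\big[Order.min/1]_i g i).
  by elim/big_ind: _ => // x y x0 y0; rewrite lt_min x0 y0.
move=> i fi; have -> : f i = g i by rewrite /g fi.
exact: bigmin_le_cond.
Qed.

Lemma sum_exchange I (f : I -> F) (S : {set I}) a b :
  a \notin S -> b \in S ->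
  #|a |: S :\ b| = #|S| /\
  \sum_(i in a |: S :\ b) f i = \sum_(i in S) f i + f a - f b.
Proof.
move=> aS bS.
have aSb : a \notin S :\ b by rewrite inE (negbTE aS) andbF.
split; first by rewrite cardsU1 aSb [RHS](cardsD1 b) bS.
rewrite big_setU1 //= [\sum_(i in S) _](big_setD1 b) //=; ring.
Qed.

(* Equality between the two extremal sums forces each column of weight
   [z j > 0] to be full or empty; the last hypothesis then lets one exchange an
   entry of a full column with one of an empty column, at a strict gain. *)
Lemma smaj_tens_lt I J (f g : I -> F) (z : J -> F) (T : {set I * J}) a b :
  smaj f g -> \sum_i f i = \sum_i g i ->
  (forall j, 0 <= z j) -> 0 < g a ->
  (forall j j', 0 < z j' -> g b * z j < g a * z j') ->
  (0 < #|T|)%N -> (exists2 j, 0 < z j & fiber T j != setT) ->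
  exists2 T' : {set I * J}, #|T'| = #|T| &
    \sum_(p in T) tens f z p < \sum_(p in T') tens g z p.
Proof.
move=> fg sfg z0 ga zz T0 [j' zj' cj'].
have [T' [c le lt]] := smaj_tensl T fg sfg z0.
have cT : #|T'| = #|T|.
  by rewrite card_fibers; under eq_bigr do rewrite c; rewrite -card_fibers.
have [/existsP[j /andP[h1 h2]]|] :=
    boolP [exists j, (0 < #|fiber T j| < #|I|)%N && (0 < z j)].
  by exists T' => //; apply: lt h1 h2.
rewrite negb_exists => /forallP hc.
have j'0 : fiber T' j' = set0.
  apply: cards0_eq; rewrite c; apply/eqP; rewrite -leqn0 leqNgt.
  move: (hc j'); rewrite zj' andbT; apply: contra => ->/=.
  rewrite ltnNge; apply: contra cj' => h.
  by rewrite eqEcard subsetT cardsT.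
have aj' : (a, j') \notin T'.
  by apply/negP => h; have : a \in fiber T' j' by [rewrite inE]; rewrite j'0 inE.
have [/existsP[j /andP[zj cj]]|] := boolP [exists j, (0 < z j) && (0 < #|fiber T j|)%N].
  have bj : (b, j) \in T'.
    have : fiber T' j = setT.
      apply/eqP; rewrite eqEcard subsetT cardsT c leqNgt.
      by move: (hc j); rewrite cj zj andbT.
    by move/setP/(_ b); rewrite !inE.
  have [cc e] := sum_exchange (tens g z) aj' bj.
  exists ((a, j') |: T' :\ (b, j)); first by rewrite cc.
  apply: le_lt_trans le _; rewrite e -addrA ltrDl subr_gt0 /tens /=; exact: zz.
(* Remaining case: [T] meets no column of positive weight. Both sums vanish, and moving any element
   of [T'] to [(a, j')] makes the second one positive. *)
rewrite negb_exists => /forallP hz.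
have sum0 (h : I -> F) S : (forall j, #|fiber S j| = #|fiber T j|) ->
    \sum_(p in S) tens h z p = 0.
  move=> cS; rewrite sum_fibers big1 // => j _.
  move: (hz j); rewrite negb_and => /orP[|].
    by rewrite -leNgt => hj; have/eqP-> : z j == 0 by [rewrite eq_le hj z0]; rewrite mul0r.
  by rewrite -leqNgt leqn0 -cS cards_eq0 => /eqP->; rewrite big_set0 mulr0.
have /card_gt0P[[b' j] bj] : (0 < #|T'|)%N by rewrite cT.
have [cc e] := sum_exchange (tens g z) aj' bj.
exists ((a, j') |: T' :\ (b', j)); first by rewrite cc.
rewrite e (sum0 _ T) // (sum0 _ T') // add0r.
have -> : tens g z (b', j) = 0.
  rewrite /tens /=; move: (hz j); rewrite negb_and => /orP[|].
    by rewrite -leNgt => hj; have/eqP-> : z j == 0 by [rewrite eq_le hj z0]; rewrite mulr0.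
  rewrite -leqNgt leqn0 -c cards_eq0 => /eqP/setP/(_ b').
  by rewrite !inE bj.
by rewrite subr0 mulr_gt0.
Qed.

(** A set goes from [I'] to [I] along [h], and the better set found in [J] goes on to [J'] along
    [h']; hence the opposite directions of the two maps. *)
Lemma smaj_inj I I' J J' (f : I -> F) (f' : I' -> F) (g : J -> F) (g' : J' -> F)
    (h : I' -> I) (h' : J -> J') :
  injective h -> injective h' -> #|I'| = #|I| ->
  (forall i, f' i = f (h i)) -> (forall j, g' (h' j) = g j) ->
  smaj f g -> smaj f' g'.
Proof.
move=> hI h'I cI fE gE fg S hS.
have [|S' cS lt] := fg (h @: S); first by rewrite card_imset // -cI.
exists (h' @: S'); first by rewrite card_imset // cS card_imset.
rewrite big_imset /=; last by move=> ? ? _ _; apply: h'I.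
under [ltRHS]eq_bigr do rewrite gE.
move: lt; rewrite big_imset /=; last by move=> ? ? _ _; apply: hI.
by under eq_bigr do rewrite -fE.
Qed.

(** * Moving a small weight from a larger coefficient to a smaller one *)

Section Transfer.
Variables (J : finType) (z : J -> F) (i0 j0 : J) (e : F).

(** A Robin Hood transfer, or T-transform, from [i0] to [j0]. *)
Definition transfer (j : J) := z j + e * (j == j0)%:R - e * (j == i0)%:R.

(** The arbitrary [G] serves for totals, sums over sets, sums of squares and tensor sums alike. *)
Lemma transfer_sum (G : J -> F) :
  \sum_j transfer j * G j = \sum_j z j * G j + e * (G j0 - G i0).
Proof.
have d (k : J) : \sum_j e * (j == k)%:R * G j = e * G k.
  rewrite (bigD1 k) //= big1 ?eqxx ?addr0 ?mulr1 // => j /negbTE->.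
  by rewrite mulr0 mul0r.
rewrite mulrBr addrA -!d -big_split -sumrB /=.
by apply: eq_bigr => j _; rewrite /transfer; ring.
Qed.

Lemma transfer_total : \sum_j transfer j = \sum_j z j.
Proof.
have := transfer_sum (fun=> 1); under eq_bigr do rewrite mulr1.
by move=> ->; rewrite subrr mulr0 addr0; under eq_bigr do rewrite mulr1.
Qed.

Hypothesis (e0 : 0 < e) (ez : e < z i0 - z j0).

Lemma transfer_neq : (i0 == j0) = false.
Proof. by apply/eqP => h; move: e0 ez; rewrite h; lra. Qed.

(** The change is [2 * e * (e - (z i0 - z j0))]. As a sum of squares ignores the order, this shows
    that the transfer is not a mere rearrangement. *)
Lemma transfer_sqr : \sum_j transfer j ^+ 2 < \sum_j z j ^+ 2.
Proof.
under eq_bigr do rewrite expr2; rewrite transfer_sum.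
under eq_bigr do rewrite mulrC; rewrite transfer_sum.
rewrite /transfer !eqxx transfer_neq eq_sym transfer_neq !mulr1 !mulr0.
under eq_bigr do rewrite -expr2.
by move: (\sum_j _) e0 ez => s; nra.
Qed.

Lemma transfer_ge0 : (forall j, 0 <= z j) -> forall j, 0 <= transfer j.
Proof.
move=> z0 j; rewrite /transfer.
have := z0 j; have := z0 j0; move: e0 ez.
case: (eqVneq j i0) => [->|_]; first by rewrite transfer_neq mulr0 mulr1; lra.
by case: (j == j0); rewrite ?mulr1 ?mulr0; lra.
Qed.

Lemma transfer_support : 0 < z j0 -> (forall j, 0 <= z j) ->
  forall j, transfer j != 0 -> 0 < z j.
Proof.
move=> zj z0 j; rewrite lt_neqAle z0 andbT /transfer; have [e1 ez1] := (e0, ez).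
case: (eqVneq j i0) => [-> _|_]; first by rewrite lt_eqF //; lra.
case: (eqVneq j j0) => [-> _|_]; first by rewrite lt_eqF.
by rewrite !mulr0 addr0 subr0 eq_sym.
Qed.

(** Only a set containing [j0] but not [i0] gains from the transfer; exchanging [j0] for [i0] then
    gains [z i0 - z j0], which exceeds [e]. *)
Lemma transfer_maj (S : {set J}) :
  exists2 S' : {set J}, #|S'| = #|S| & \sum_(j in S) transfer j <= \sum_(j in S') z j.
Proof.
have E (h : J -> F) (U : {set J}) :
    \sum_(j in U) h j = \sum_j h j * (j \in U)%:R.
  by rewrite big_mkcond; apply: eq_bigr => j _; case: ifP; rewrite ?mulr1 ?mulr0.
have := transfer_sum (fun j => (j \in S)%:R); rewrite -!E => ->.
have [e1 ez1] := (e0, ez); have [hi|hi] := boolP (i0 \in S).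
  by exists S => //; case: (j0 \in S); rewrite ?subrr ?mulr0 ?addr0 // sub0r mulrN1; lra.
have [hj|hj] := boolP (j0 \in S); last by exists S => //; rewrite subrr mulr0 addr0.
have [cc s] := sum_exchange z hi hj.
by exists (i0 |: S :\ j0) => //; rewrite s subr0 mulr1; lra.
Qed.

End Transfer.

Lemma catalyst_transfer I J (f g : I -> F) (z : J -> F) (a b : I) (i0 j0 : J) :
  smaj f g -> \sum_i f i = 1 -> \sum_i g i = 1 -> (forall i, 0 <= g i) ->
  (forall j, 0 <= z j) -> 0 < z j0 -> z j0 < z i0 -> 0 < g a ->
  (forall j j', 0 < z j' -> g b * z j < g a * z j') ->
  exists2 e, 0 < e < z i0 - z j0 & forall T : {set I * J},
    exists2 T' : {set I * J}, #|T'| = #|T| &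
      \sum_(p in T) tens f z p <= \sum_(p in T') tens g (transfer z i0 j0 e) p.
Proof.
move=> fg sf sg g0 z0 zj0 zij ga zz.
(* [c] bounds from below all positive gaps over the finitely many pairs of sets, so that [e] can be
   fixed before [T]. *)
have [c c0 hc] := pos_lower_bound (fun TT : {set I * J} * {set I * J} =>
  \sum_(p in TT.2) tens g z p - \sum_(p in TT.1) tens f z p).
pose e := Num.min c ((z i0 - z j0) / 2).
have e0 : 0 < e by rewrite lt_min c0 /=; lra.
have ec : e <= c by rewrite ge_min lexx.
have ez : e < z i0 - z j0.
  have : e <= (z i0 - z j0) / 2 by rewrite ge_min lexx orbT.
  by lra.
exists e; first by rewrite e0.
move=> T; have [/existsP[j /andP[zj cj]]|] :=
    boolP [exists j, (0 < z j) && (fiber T j != setT)]; last first.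
  (* Every column of positive weight is full: both sums reduce to the total weight, which the
     transfer preserves without enlarging the support. *)
  rewrite negb_exists => /forallP hT; exists T => //.
  have full j : 0 < z j -> fiber T j = setT.
    by move=> zj; move: (hT j); rewrite zj negbK => /eqP.
  have setTs (h : I -> F) : \sum_(i in setT) h i = \sum_i h i.
    by apply: eq_bigl => i; rewrite inE.
  rewrite !sum_fibers; set w := transfer _ _ _ _.
  have -> : \sum_j z j * (\sum_(i in fiber T j) f i) = \sum_j z j.
    apply: eq_bigr => j _; have := z0 j; rewrite le_eqVlt => /orP[/eqP<-|zj].
      by rewrite mul0r.
    by rewrite full // setTs sf mulr1.
  have -> : \sum_j w j * (\sum_(i in fiber T j) g i) = \sum_j w j.
    apply: eq_bigr => j _; have [->|wj] := eqVneq (w j) 0; first by rewrite mul0r.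
    by rewrite full ?setTs ?sg ?mulr1 //; apply: (transfer_support e0 ez zj0 z0 wj).
  by rewrite transfer_total.
have [T0|T0] := posnP #|T|.
  by exists T => //; rewrite (cards0_eq T0) !big_set0.
have [|T' cT lt] := smaj_tens_lt fg _ z0 ga zz T0 (ex_intro2 _ _ j zj cj).
  by rewrite sf sg.
exists T' => //; rewrite [leRHS]sum_fibers transfer_sum -sum_fibers.
have := hc (T, T'); rewrite /= subr_gt0 => /(_ lt) h.
(* Fiber sums of [g] lie between 0 and 1, so the transfer costs at most [e], and hence at most the
   gap [c]. *)
have le1 (S : {set I}) : 0 <= \sum_(i in S) g i <= 1.
  rewrite sumr_ge0 //= -sg [leRHS](bigID (mem S)) /= lerDl; exact: sumr_ge0.
have /andP[h1 _] := le1 (fiber T' j0); have /andP[_ h2] := le1 (fiber T' i0).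
set x := \sum_(i in fiber T' j0) _ in h1 *; set y := \sum_(i in fiber T' i0) _ in h2 *.
have : e * (x - y + 1) >= 0 by rewrite mulr_ge0 ?(ltW e0) //; lra.
by lra.
Qed.

End SetMajorization.

(** Supplies the threshold on the number of copies, with [m] and [M] two distinct coefficients of
    phi and [c] a lower bound for the positive ones of chi. *)
Lemma geometric_lt (F : archiRealFieldType) (m M c : F) : 0 <= m -> m < M -> 0 < c ->
  exists K : nat, forall k, (K <= k)%N -> m ^+ k < c * M ^+ k.
Proof.
move=> m0 mM c0; have M0 : 0 < M by apply: le_lt_trans mM.
pose q := m / M; pose t := 1 - q.
have q0 : 0 <= q by rewrite divr_ge0 // ltW.
have t0 : 0 < t by rewrite subr_gt0 ltr_pdivrMr // mul1r.
(* A Bernoulli-type bound: the induction step is [(1 - t) * (1 + (k + 1) * t) <= 1 + k * t]. *)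
have B k : q ^+ k * (1 + k%:R * t) <= 1.
  elim: k => [|k IH]; first by rewrite expr0 mul0r addr0 mulr1.
  apply: le_trans IH; rewrite exprSr -mulrA ler_wpM2l ?exprn_ge0 //.
  have : 0 <= k%:R :> F by [].
  have -> : q = 1 - t by rewrite /t; ring.
  by rewrite -natr1; nra.
exists (Num.bound (c * t)^-1) => k hk.
have k1 : 1 < c * (k%:R * t).
  have : (c * t)^-1 < k%:R.
    apply: lt_le_trans (archi_boundP _) _; first by rewrite invr_ge0 ltW ?mulr_gt0.
    by rewrite ler_nat.
  have ct : 0 < c * t by rewrite mulr_gt0.
  by rewrite -[_ < k%:R](ltr_pM2l ct) mulfV ?gt_eqF // -mulrA [t * _]mulrC.
suff : q ^+ k < c by rewrite expr_div_n ltr_pdivrMr ?exprn_gt0.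
have qk : 0 <= q ^+ k by rewrite exprn_ge0.
have := B k; rewrite ltNge; apply: contraTN => cq; rewrite -ltNge.
move: (q ^+ k) cq qk k1 => u; move: (k%:R * t) => v; nra.
Qed.

(** * Singular value decompositions: uniqueness and tensor products *)

Section Unitary.
Variable C : numClosedFieldType.
Local Open Scope sesquilinear_scope.

Lemma gram_unitary_diag n (A U V : 'M[C]_n) d :
  U \is unitarymx -> V \is unitarymx -> A = U^T *m diag_mx d *m V ->
  exists2 P : 'M[C]_n, P \in unitmx &
    A *m A ^t* = invmx P *m diag_mx (\row_i (d 0 i * (d 0 i)^*)) *m P.
Proof.
move=> uU uV AE.
have uC : map_mx Num.conj U \is unitarymx by rewrite conjC_unitary.
(* [V] cancels in [A *m A ^t*], and [U^T] is the adjoint, hence the inverse, of the conjugate of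
   [U]. *)
exists (map_mx Num.conj U); first exact: unitarymx_unit.
rewrite invmx_unitary // AE trmx_mul map_mxM mulmxA mulmxtVK //.
rewrite trmx_mul trmxK tr_diag_mx map_mxM map_diag_mx mulmxA.
congr (_ *m _).
have -> : (map_mx Num.conj U) ^t* = U^T.
  by apply/matrixP => i j; rewrite !mxE conjCK.
rewrite -mulmxA; congr (_ *m _); rewrite mulmx_diag; congr diag_mx.
by apply/rowP => i; rewrite !mxE.
Qed.

Lemma unitary_tens p q (U : 'M[C]_p) (V : 'M[C]_q) : U \is unitarymx ->
  V \is unitarymx -> U *t V \is unitarymx.
Proof.
move=> /unitarymxP uU /unitarymxP uV; apply/unitarymxP.
rewrite trmx_tens map_mxT tensmx_mul uU uV; apply/matrixP => i j.
case: (mxtens_indexP i) => i1 i2; case: (mxtens_indexP j) => j1 j2.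
rewrite tensmxE !mxE -natrM mulnb (can_eq (@mxtens_indexK _ _)).
by rewrite xpair_eqE.
Qed.

Lemma gram_char_poly n (A P : 'M[C]_n) d : P \in unitmx ->
  A *m A ^t* = invmx P *m diag_mx d *m P ->
  char_poly (A *m A ^t*) = \prod_(x <- [seq d 0 i | i <- enum 'I_n]) ('X - x%:P).
Proof.
move=> Pu ->; rewrite big_map big_enum /=.
transitivity (char_poly (diag_mx d)).
  rewrite /char_poly /char_poly_mx !map_mxM /= map_invmx.
  set Q := map_mx _ P.
  have Qu : Q \in unitmx by rewrite map_unitmx //.
  rewrite -[X in \det (X - _)](mulKmx Qu) scalar_mxC -mulmxA -mulmxBr -mulmxBl.
  by rewrite !det_mulmx mulrCA det_inv mulVr ?mulr1 // -unitmxE.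
rewrite char_poly_trig ?diag_mx_is_trig //.
by apply: eq_bigr => i _; rewrite !mxE eqxx mulr1n.
Qed.

Lemma gram_trace n (A P : 'M[C]_n) d : P \in unitmx ->
  A *m A ^t* = invmx P *m diag_mx d *m P ->
  \sum_i \sum_j `|A i j| ^+ 2 = \sum_i d 0 i.
Proof.
move=> Pu E; transitivity (\tr (A *m A ^t*)).
  apply: eq_bigr => i _; rewrite mxE; apply: eq_bigr => j _.
  by rewrite !mxE normCK.
by rewrite E -mulmxA mxtrace_mulC mulmxK // mxtrace_diag.
Qed.

(** Both lists consist of the roots of the characteristic polynomial of [A *m A ^t*], with
    multiplicity. *)
Lemma svd_perm n (A U V U' V' : 'M[C]_n) d d' :
  U \is unitarymx -> V \is unitarymx -> A = U^T *m diag_mx d *m V ->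
  U' \is unitarymx -> V' \is unitarymx -> A = U'^T *m diag_mx d' *m V' ->
  perm_eq [seq d 0 i * (d 0 i)^* | i <- enum 'I_n]
          [seq d' 0 i * (d' 0 i)^* | i <- enum 'I_n].
Proof.
move=> uU uV E uU' uV' E'.
have [P Pu /(gram_char_poly Pu) h] := gram_unitary_diag uU uV E.
have [P' Pu' /(gram_char_poly Pu')] := gram_unitary_diag uU' uV' E'.
rewrite h => /prod_XsubC_eq.
have eR (c : 'rV[C]_n) : [seq (\row_i (c 0 i * (c 0 i)^*)) 0 i | i <- enum 'I_n]
    = [seq c 0 i * (c 0 i)^* | i <- enum 'I_n].
  by apply: eq_map => i; rewrite mxE.
by rewrite !eR.
Qed.

Lemma svd_norm n (A U V : 'M[C]_n) d :
  U \is unitarymx -> V \is unitarymx -> A = U^T *m diag_mx d *m V ->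
  \sum_i \sum_j `|A i j| ^+ 2 = \sum_i d 0 i * (d 0 i)^*.
Proof.
move=> uU uV /(gram_unitary_diag uU uV)[P Pu /(gram_trace Pu) ->].
by apply: eq_bigr => i _; rewrite mxE.
Qed.

Lemma svd_tens p q (A U V : 'M[C]_p) (B U' V' : 'M[C]_q)
    d d' (e : 'rV[C]_(p * q)) :
  A = U^T *m diag_mx d *m V -> B = U'^T *m diag_mx d' *m V' ->
  (forall i j, e 0 (mxtens_index (i, j)) = d 0 i * d' 0 j) ->
  A *t B = (U *t U')^T *m diag_mx e *m (V *t V').
Proof.
move=> -> -> eE; rewrite -!tensmx_mul trmx_tens; congr (_ *m _ *m _).
apply/matrixP => i j.
case: (mxtens_indexP i) => i1 i2; case: (mxtens_indexP j) => j1 j2.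
rewrite tensmxE !mxE eE (can_eq (@mxtens_indexK _ _)) xpair_eqE.
by case: (i1 == j1); case: (i2 == j2); rewrite ?mulr1n ?mulr0n ?mulr0 ?mul0r.
Qed.

End Unitary.

(** * Unordered Schmidt coefficients *)

Section Svals.
Variable R : realType.
Local Open Scope complex_scope.

(* Unlike in [schmidt_decomposition] the coefficients are not ordered, so that
   [kron a b] is again a vector of this kind for a Kronecker product. *)
Definition svals n (A : 'M[R[i]]_n) (a : 'rV[R]_n) : Prop :=
  (forall i, 0 <= a 0 i) /\
  exists U V : 'M[R[i]]_n, [/\ U \is unitarymx, V \is unitarymx
    & A = U^T *m diag_mx (\row_i (Num.sqrt (a 0 i))%:C) *m V].


Lemma svals_schmidt n (psi : state R n) : svals psi (schmidt_vector psi).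
Proof.
rewrite /schmidt_vector; case: cid => a /= [a0 _ [U [V [uU uV E]]]].
split=> //; exists U, V; split=> //; rewrite E; apply/matrixP => i j.
rewrite summxE mxE; apply: eq_bigr => l _.
by rewrite mul_mx_diag !mxE big_ord1 !mxE mulrCA mulrA.
Qed.

Lemma sqrt_conj (x : R) : 0 <= x ->
  (Num.sqrt x)%:C * ((Num.sqrt x)%:C)^*%R = x%:C :> R[i].
Proof.
by move=> x0; rewrite conj_Creal ?complex_real // -rmorphM /= -expr2 sqr_sqrtr.
Qed.

Lemma svals_perm n (A : 'M[R[i]]_n) a b : svals A a -> svals A b ->
  perm_eq [seq a 0 i | i <- enum 'I_n] [seq b 0 i | i <- enum 'I_n].
Proof.
move=> [a0 [U [V [uU uV E]]]] [b0 [U' [V' [uU' uV' E']]]].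
have := svd_perm uU uV E uU' uV' E'.
have eR (c : 'rV[R]_n) : (forall i, 0 <= c 0 i) ->
    [seq (\row_i (Num.sqrt (c 0 i))%:C) 0 i * ((\row_i (Num.sqrt (c 0 i))%:C) 0 i)^*%R
     | i <- enum 'I_n] = map (real_complex R) [seq c 0 i | i <- enum 'I_n].
  by move=> c0; elim: (enum _) => //= i s ->; rewrite !mxE sqrt_conj.
rewrite !eR //; apply: perm_map_inj; exact: fmorph_inj.
Qed.

Lemma svals_norm2 n (A : 'M[R[i]]_n) a : svals A a ->
  norm2 A = (\sum_i a 0 i)%:C.
Proof.
move=> [a0 [U [V [uU uV E]]]]; apply: etrans (svd_norm uU uV E) _.
by rewrite rmorph_sum; apply: eq_bigr => i _; rewrite mxE sqrt_conj.
Qed.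

Lemma svals_sum1 n (psi : state R n) a : svals psi a -> \sum_i a 0 i = 1.
Proof.
move=> /svals_norm2; rewrite state_norm => /esym/(@complexI R); exact.
Qed.

Lemma kronE m n (a : 'rV[R]_m) (b : 'rV[R]_n) i j :
  kron a b 0 (mxtens_index (i, j)) = a 0 i * b 0 j.
Proof. by rewrite mxE mxtens_indexK /= [X in a X]ord1 [X in b X]ord1. Qed.

Lemma svals_tens m n (A : 'M[R[i]]_m) (B : 'M[R[i]]_n) a b :
  svals A a -> svals B b -> svals (A *t B) (kron a b).
Proof.
move=> [a0 [U [V [uU uV E]]]] [b0 [U' [V' [uU' uV' E']]]].
split=> [i|]; first by case: (mxtens_indexP i) => i1 i2; rewrite kronE mulr_ge0.
exists (U *t U'), (V *t V'); split.
- exact: (unitary_tens uU uU').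
- exact: (unitary_tens uV uV').
apply: (svd_tens E E') => i j.
by rewrite mxE kronE sqrtrM // rmorphM !mxE.
Qed.

(** The diagonal amplitude matrix with entries the square roots of [w] is such a state. *)
Lemma state_of_svals n (w : 'rV[R]_n) : (forall i, 0 <= w 0 i) ->
  \sum_i w 0 i = 1 -> exists psi : state R n, svals psi w.
Proof.
move=> w0 w1.
have h : svals (diag_mx (\row_i (Num.sqrt (w 0 i))%:C)) w.
  have u1 : (1%:M : 'M[R[i]]_n) \is unitarymx.
    by apply/unitarymxP; rewrite trmx1 map_mx1 mulmx1.
  by split=> //; exists 1%:M, 1%:M; split=> //; rewrite trmx1 mul1mx mulmx1.
have E := svals_norm2 h; rewrite w1 in E.
by exists (State E).
Qed.

Lemma perm_eq_row_perm n (a b : 'rV[R]_n) :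
  perm_eq [seq a 0 i | i <- enum 'I_n] [seq b 0 i | i <- enum 'I_n] ->
  exists s : 'S_n, forall i, a 0 i = b 0 (s i).
Proof.
move=> h; have : perm_eq [tuple a 0 i | i < n] [tuple b 0 i | i < n].
  exact: h.
move=> /tuple_permP[s E]; exists s => i.
have := congr1 (fun u => nth 0 u i) E.
by rewrite -!tnth_nth !tnth_mktuple.
Qed.

End Svals.

(** * Sums of largest entries as maxima over index sets *)

Section LargestSum.
Variable R : realType.

Lemma largest_sum_size n (x : 'rV[R]_n) : largest_sum n x = \sum_i x 0 i.
Proof.
rewrite /largest_sum take_oversize; last first.
  by rewrite size_sort size_map size_enum_ord.
rewrite (perm_big _ (permEl (perm_sort _ _))) big_map big_enum //.
Qed.

Lemma sum_le_take_sorted (s t : seq R) : sorted >=%R s ->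
  (exists u, perm_eq s (t ++ u)) ->
  \sum_(a <- t) a <= \sum_(a <- take (size t) s) a.
Proof.
elim: t s => [|x t IH] s ss [u su]; first by rewrite big_nil take0 big_nil.
have xs : x \in s by rewrite (perm_mem su) inE eqxx.
pose k := index x s.
have kl : (k < size s)%N by rewrite index_mem.
have ps := perm_to_rem xs.
have su' : perm_eq (rem x s) (t ++ u).
  by rewrite -(perm_cons x) -(permPl ps).
have := IH (rem x s) (subseq_sorted ge_trans (rem_subseq _ _) ss) (ex_intro _ u su').
rewrite big_cons => h.
(* It remains to bound [x] plus a prefix of [rem x s] by the prefix of [s] one longer. By induction
   on [s]: if [x] lies beyond that prefix, it is at most its last entry. *)
apply: le_trans (lerD (lexx x) h) _ => {h IH su' ps su}.
rewrite [size (_ :: _)]/=; move: ss xs; move: (size t) => m {k kl t u}.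
elim: s m => [//|y s IH] m; rewrite /= inE eq_sym.
case: (eqVneq y x) => [->|yx] ss /=; first by rewrite big_cons.
move=> xs; rewrite big_cons.
case: m => [|m].
  rewrite !take0 !big_nil lerD2r.
  exact: (allP (order_path_min ge_trans ss)).
by rewrite big_cons addrCA lerD2l; apply: IH => //; apply: path_sorted ss.
Qed.

(** The map [h] allows [S] to be a set of pairs, for entries of a Kronecker product. *)
Lemma le_largest_sum (I : finType) n (x : 'rV[R]_n) (h : I -> 'I_n) (S : {set I}) :
  injective h -> \sum_(i in S) x 0 (h i) <= largest_sum #|S| x.
Proof.
move=> hI; rewrite /largest_sum.
pose t := [seq x 0 (h i) | i <- enum S].
have -> : \sum_(i in S) x 0 (h i) = \sum_(a <- t) a by rewrite big_map big_enum.
have -> : #|S| = size t by rewrite size_map cardE.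
apply: sum_le_take_sorted; first exact/sort_sorted/ge_total.
exists [seq x 0 i | i <- enum (~: (h @: S))].
rewrite perm_sort /t (map_comp (fun i => x 0 i) h) -map_cat; apply: perm_map.
apply: uniq_perm; rewrite ?enum_uniq //.
  rewrite cat_uniq map_inj_uniq // !enum_uniq /= andbT.
  apply/hasPn => i /=; rewrite mem_enum inE; apply: contra.
  by move=> /mapP[j]; rewrite mem_enum => jS ->; apply: imset_f.
move=> i; rewrite mem_cat !mem_enum [LHS]inE [in RHS]in_setC; apply/esym.
have [/imsetP[j jS ->]|_] := boolP (i \in h @: S); last by rewrite orbT.
by rewrite map_f ?mem_enum.
Qed.

Lemma largest_sum_set n (x : 'rV[R]_n) l : (l <= n)%N ->
  exists2 S : {set 'I_n}, #|S| = l & \sum_(i in S) x 0 i = largest_sum l x.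
Proof.
move=> ln; rewrite /largest_sum.
pose t := [seq x 0 i | i <- enum 'I_n].
have : perm_eq (decreasing x) t by rewrite perm_sort.
(* [Is] lists the indices in the order of the sorted values; working with indices keeps repeated
   values apart. *)
move=> /(perm_iotaP 0)[Is hIs E].
have sI : size Is = n by rewrite (perm_size hIs) size_iota size_map size_enum_ord.
have uI : uniq Is by rewrite (perm_uniq hIs) iota_uniq.
have Ilt k : k \in Is -> (k < n)%N.
  by rewrite (perm_mem hIs) mem_iota size_map size_enum_ord.
pose S := [set i : 'I_n | val i \in take l Is].
have pS : perm_eq [seq val i | i <- enum S] (take l Is).
  apply: uniq_perm; last move=> k.
  - by rewrite map_inj_uniq ?enum_uniq //; apply: val_inj.
  - exact: take_uniq.
  apply/mapP/idP => [[i iS ->] | kI]; first by move: iS; rewrite mem_enum inE.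
  by exists (Ordinal (Ilt k (mem_take kI))) => //; rewrite mem_enum inE.
exists S; first by rewrite cardE -(size_map val) (perm_size pS) size_takel // sI.
rewrite E -map_take big_map -(perm_big _ pS) big_map big_enum /=.
by apply: eq_bigr => i _; rewrite (nth_map i) ?size_enum_ord // nth_ord_enum.
Qed.

End LargestSum.

(** * Schmidt vectors of tensor powers *)

Section States.
Variable R : realType.

Lemma strictly_majorized_smaj n (x y : 'rV[R]_n) :
  strictly_majorized x y -> smaj (x 0) (y 0).
Proof.
move=> [lt _] S; rewrite card_ord => hS.
have [|S' cS E] := largest_sum_set y (l := #|S|).
  by case/andP: hS => _ /ltnW.
exists S' => //; rewrite E; apply: le_lt_trans (lt _ hS).
exact: (le_largest_sum x S (h := id)).
Qed.

Lemma smaj_kron m n (a b : 'rV[R]_m) (a' b' : 'rV[R]_n) :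
  smaj (tens (a 0) (a' 0)) (tens (b 0) (b' 0)) ->
  smaj (kron a a' 0) (kron b b' 0).
Proof.
apply: (smaj_inj (h := @mxtens_unindex m n) (h' := @mxtens_index m n)).
- exact/can_inj/mxtens_unindexK.
- exact/can_inj/mxtens_indexK.
- by rewrite card_prod !card_ord.
- by move=> i; case: (mxtens_indexP i) => i1 i2; rewrite kronE mxtens_indexK.
- by case=> i j; rewrite kronE.
Qed.

(** Induction from the first power, where there is already more than one index, as the positivity
    from [smaj_gt0] requires. The powers of [f 0 a] and [f 0 b] are followed along as entries of
    [y]. *)
Lemma svals_power n (psi phi : state R n) (p f : 'rV[R]_n) (a b : 'I_n) k :
  (1 < n)%N -> svals psi p -> svals phi f -> smaj (p 0) (f 0) ->
  exists x y : 'rV[R]_(n ^ k.+1), [/\ svals (tensor_power psi k.+1) x,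
    svals (tensor_power phi k.+1) y, smaj (x 0) (y 0),
    exists i, y 0 i = f 0 a ^+ k.+1 & exists j, y 0 j = f 0 b ^+ k.+1].
Proof.
move=> n1 sp sf pf; have [[p0 _] [f0 _]] := (sp, sf).
have e1 : \sum_i p 0 i = \sum_i f 0 i by rewrite (svals_sum1 sp) (svals_sum1 sf).
elim: k => [|k [x [y [sx sy xy [i yi] [j yj]]]]].
  by exists p, f; split=> //; [exists a|exists b].
have [[x0 _] [y0 _]] := (sx, sy).
have e2 : \sum_i x 0 i = \sum_i y 0 i by rewrite (svals_sum1 sx) (svals_sum1 sy).
exists (kron p x), (kron f y); split.
- exact: svals_tens sp sx.
- exact: svals_tens sf sy.
- apply: smaj_kron; apply: smaj_tens => //.
    by apply: (smaj_gt0 _ pf e1); rewrite ?card_ord.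
  by apply: (smaj_gt0 _ xy e2) => //; rewrite card_ord -(expn0 n) ltn_exp2l.
- by exists (mxtens_index (a, i)); rewrite kronE yi [RHS]exprS.
- by exists (mxtens_index (b, j)); rewrite kronE yj [RHS]exprS.
Qed.

(** [schmidt_vector] comes from a chosen decomposition; coefficients obtained otherwise are matched
    with it up to order. *)
Lemma schmidt_perm n (psi : state R n) a : svals psi a ->
  exists s : 'S_n, forall i, schmidt_vector psi 0 i = a 0 (s i).
Proof.
by move=> sa; apply/perm_eq_row_perm/(svals_perm (svals_schmidt psi)).
Qed.

Lemma partially_entangled_neq n (phi : state R n) : partially_entangled phi ->
  exists a b, schmidt_vector phi 0 b < schmidt_vector phi 0 a.
Proof.
move=> ne; have [/existsP[a /existsP[b h]]|] :=
  boolP [exists a, exists b, schmidt_vector phi 0 b < schmidt_vector phi 0 a].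
  by exists a, b.
rewrite negb_exists => /forallP h; exfalso; apply: ne => i.
have E j : schmidt_vector phi 0 j = schmidt_vector phi 0 i.
  move: (h i) (h j); rewrite !negb_exists => /forallP/(_ j) h1 /forallP/(_ i) h2.
  by apply/eqP; rewrite eq_le !leNgt h1 h2.
have := svals_sum1 (svals_schmidt phi); under eq_bigr do rewrite E.
rewrite sumr_const card_ord -[_ *+ n]mulr_natl => h1.
have n0 : n%:R != 0 :> R by apply/eqP => n0; move: h1; rewrite n0 mul0r => /eqP; rewrite eq_sym oner_eq0.
by apply: (mulfI n0); rewrite h1 mulfV.
Qed.

End States.

Theorem theorem6p2 (R : realType) (n r : nat) (phi : state R n)
    (chi : state R r) :
  partially_entangled phi -> partially_entangled chi ->
  (exists i j : 'I_r, [/\ schmidt_vector chi ord0 i <> 0,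
     schmidt_vector chi ord0 j <> 0 &
     schmidt_vector chi ord0 i <> schmidt_vector chi ord0 j]) ->
  exists k0 : nat, (0 < k0)%N /\
    forall k : nat, (k0 <= k)%N -> forall psi : state R n, So phi psi ->
      partial_recovery (tensor_power psi k) (tensor_power phi k) chi.
Proof.
move=> /partially_entangled_neq[a [b fba]] _ hij.
pose f := schmidt_vector phi; pose z := schmidt_vector chi.
have [f0 _] := svals_schmidt phi; have [z0 _] := svals_schmidt chi.
have sz := svals_sum1 (svals_schmidt chi).
have [i0 [j0 [zj zij]]] : exists i0 j0, 0 < z 0 j0 /\ z 0 j0 < z 0 i0.
  have [i [j [/eqP hi /eqP hj /eqP hne]]] := hij.
  have pi : 0 < z 0 i by rewrite lt_neqAle eq_sym hi z0.
  have pj : 0 < z 0 j by rewrite lt_neqAle eq_sym hj z0.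
  by case/orP: (lt_total hne) => h; [exists j, i|exists i, j].
have n1 : (1 < n)%N.
  rewrite ltnNge; apply/negP => n1.
  have v0 (i : 'I_n) : i = 0%N :> nat.
    by apply/eqP; rewrite -leqn0 -ltnS (leq_trans (ltn_ord i)).
  have ab : a = b by apply/val_inj; rewrite /= !v0.
  by move: fba; rewrite ab ltxx.
(* [c] and [K] depend on phi and chi only, which makes the threshold uniform in psi. Taking [K.+1]
   below excludes the power 0. *)
have [c c0 hc] := pos_lower_bound (z 0).
have [K hK] := geometric_lt (f0 b) fba c0.
exists K.+1; split=> // -[//|k] hk psi psio.
have sp := svals_schmidt psi; have sf := svals_schmidt phi.
have [x' [y' [sx sy xy [a' ya] [b' yb]]]] :=
  svals_power a b k n1 sp sf (strictly_majorized_smaj psio).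
have [s hs] := schmidt_perm sx; have [t ht] := schmidt_perm sy.
set x := schmidt_vector (tensor_power psi k.+1) in hs.
set y := schmidt_vector (tensor_power phi k.+1) in ht.
have {}xy : smaj (x 0) (y 0).
  apply: smaj_inj (hs) _ xy; [exact: perm_inj|exact: (@perm_inj _ t^-1%g)|by []|].
  by move=> j; rewrite ht permKV.
have [x0 _] : svals (tensor_power psi k.+1) x := svals_schmidt _.
have [y0 _] : svals (tensor_power phi k.+1) y := svals_schmidt _.
have sx1 : \sum_i x 0 i = 1 := svals_sum1 (svals_schmidt _).
have sy1 : \sum_i y 0 i = 1 := svals_sum1 (svals_schmidt _).
have yA : y 0 (t^-1%g a') = f 0 a ^+ k.+1 by rewrite ht permKV.
have yB : y 0 (t^-1%g b') = f 0 b ^+ k.+1 by rewrite ht permKV.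
have fa : 0 < f 0 a by apply: le_lt_trans fba.
have z1 j : z 0 j <= 1.
  by rewrite -sz (bigD1 j) //= lerDl sumr_ge0.
have [||e /andP[e0 ez] He] := catalyst_transfer xy sx1 sy1 y0 z0 zj zij
    (a := t^-1%g a') (b := t^-1%g b').
- by rewrite yA exprn_gt0.
(* Here [z 0 j] is at most 1 and [z 0 j'] at least [c], so the choice of [K] suffices. *)
- move=> j j' zj'; rewrite yA yB.
  apply: (@le_lt_trans _ _ (f 0 b ^+ k.+1)).
    by rewrite ler_piMr // exprn_ge0.
  apply: lt_le_trans (hK _ (ltnW hk)) _.
  by rewrite mulrC ler_wpM2l ?hc // exprn_ge0 // ltW.
pose w : 'rV[R]_r := \row_j transfer (z 0) i0 j0 e j.
have wE j : w 0 j = transfer (z 0) i0 j0 e j by rewrite mxE.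
have w0 j : 0 <= w 0 j by rewrite wE; apply: transfer_ge0.
have w1 : \sum_j w 0 j = \sum_j z 0 j.
  by under eq_bigr do rewrite wE; rewrite transfer_total.
have [|omega so] := state_of_svals w0; first by rewrite w1.
have [u hu] := schmidt_perm so.
set om := schmidt_vector omega in hu.
have so1 : \sum_i om 0 i = 1 := svals_sum1 (svals_schmidt _).
have sumk m p (v : 'rV[R]_m) (v' : 'rV[R]_p) :
    \sum_i kron v v' 0 i = (\sum_i v 0 i) * \sum_i v' 0 i.
  rewrite -sum_tens (reindex (@mxtens_index m p)) /=.
    by apply: eq_bigr => -[i j] _; rewrite kronE.
  by exists (@mxtens_unindex m p) => i _; rewrite (mxtens_indexK, mxtens_unindexK).
exists omega; rewrite -/x -/y -/om -/z; split.
- split=> [l /andP[_ /ltnW hl]|]; last first.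
    by rewrite !largest_sum_size !sumk sx1 sy1 so1 sz.
  have [S cS <-] := largest_sum_set (kron x z) hl.
  pose T := @mxtens_unindex _ _ @: S.
  have [T' cT le] := He T.
  have <- : #|T'| = l.
    by rewrite cT card_imset //; apply/can_inj/mxtens_unindexK.
  have -> : \sum_(i in S) kron x z 0 i = \sum_(p in T) tens (x 0) (z 0) p.
    rewrite big_imset /=; last by move=> ? ? _ _; apply/can_inj/mxtens_unindexK.
    by apply: eq_bigr => i _; case: (mxtens_indexP i) => i1 i2; rewrite kronE mxtens_indexK.
  apply: le_trans le _.
  (* The inverse of [u] turns an index of [w] into the matching index of the Schmidt vector of
     [omega]. *)
  pose h p := mxtens_index (p.1, u^-1%g p.2) : 'I_(n ^ k.+1 * r).
  have hI : injective h.
    by move=> [i j] [i' j'] /(can_inj (@mxtens_indexK _ _)) [-> /perm_inj->].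
  apply: le_trans (le_largest_sum (kron y om) T' hI).
  by apply: ler_sum => -[i j] _; rewrite kronE hu permKV wE.
- split=> [l /andP[_ /ltnW hl]|]; last first.
    by rewrite !largest_sum_size so1 sz.
  have [S cS <-] := largest_sum_set om hl.
  have [S' cS' le] := transfer_maj e0 ez (u @: S).
  have <- : #|S'| = l by rewrite cS' card_imset //; apply: perm_inj.
  apply: le_trans (le_largest_sum z S' (h := id) _) => //; apply: le_trans le.
  rewrite big_imset /=; last by move=> ? ? _ _; apply: perm_inj.
  by apply: ler_sum => i _; rewrite hu wE.
(* Equal rearrangements would have equal sums of squares. *)
move=> E; have := transfer_sqr e0 ez; rewrite ltNge => /negP; apply.
have sq (v : 'rV[R]_r) : \sum_(q <- decreasing v) q ^+ 2 = \sum_j v 0 j ^+ 2.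
  by rewrite (perm_big _ (permEl (perm_sort _ _))) big_map big_enum.
rewrite -(sq z) -E sq [leRHS](reindex_inj (@perm_inj _ u)) /=.
by apply: ler_sum => i _; rewrite hu wE.
Qed.
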